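(* Let $\varphi\colon\mathbb{S}\to\mathcal{I}$ be any forecasting system, let $S\colon\mathbb{S}\to\{0,1\}$ be any selection process, and let $h$ be any gamble on $\{0,1\}$. Then, almost surely for the forecasting system $\varphi$, if $\lim_{n\to\infty}\sum_{k=0}^{n-1}S(\omega_{1:k})=\infty$ then also $$\liminf_{n\to\infty}\frac{\sum_{k=0}^{n-1}S(\omega_{1:k})\left[h(\omega_{k+1})-\underline{E}_{\varphi(\omega_{1:k})}(h)\right]}{\sum_{k=0}^{n-1}S(\omega_{1:k})}\ge 0.$$ That is, the set of paths $\omega\in\Omega$ for which this implication fails is null for $\varphi$.
   Context: Notation: $\mathbb{N}=\{1,2,\dots\}$, $\mathbb{N}_0=\mathbb{N}\cup\{0\}$. Situations are the finite binary sequences $\mathbb{S}=\bigcup_{n\in\mathbb{N}_0}\{0,1\}^n$, with $\square$ the empty sequence; $sx$ is $s$ with $x\in\{0,1\}$ appended. Paths are elements $\omega$ of $\Omega=\{0,1\}^{\mathbb{N}}$, with $n$-th entry $\omega_n$; $\omega_{1:n}\in\mathbb{S}$ consists of the first $n$ entries, $\omega_{1:0}=\square$. $\mathcal{I}$ is the set of non-empty closed subintervals of $[0,1]$. A gamble on $\{0,1\}$ is a map $f\colon\{0,1\}\to\mathbb{R}$. With $E_p(f)=pf(1)+(1-p)f(0)$, put $\underline{E}_I(f)=\min_{p\in I}E_p(f)$ and $\overline{E}_I(f)=\max_{p\in I}E_p(f)$ for $I\in\mathcal{I}$. A forecasting system is a map $\varphi\colon\mathbb{S}\to\mathcal{I}$.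 A selection process is a map $S\colon\mathbb{S}\to\{0,1\}$ (no computability is assumed). The quotient is given the value $0$ when its denominator is $0$. A real process is a map $F\colon\mathbb{S}\to\mathbb{R}$, with $\Delta F(s)(x)=F(sx)-F(s)$. A supermartingale for $\varphi$ is a real process $M$ with $\overline{E}_{\varphi(s)}(\Delta M(s))\le 0$ for all $s\in\mathbb{S}$. For $A\subseteq\Omega$ with indicator $\mathbb{I}_A$, the upper probability is $$\overline{P}^{\varphi}(A)=\inf\{M(\square): M\text{ a supermartingale for }\varphi\text{ with }\liminf_{n\to\infty}M(\omega_{1:n})\ge\mathbb{I}_A(\omega)\text{ for all }\omega\in\Omega\}.$$ $A$ is null for $\varphi$ if $\overline{P}^{\varphi}(A)=0$; a property holds almost surely for $\varphi$ if it holds except perhaps on a null event. *)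

(* Defs.v *)
From HB Require Import structures.
From mathcomp Require Import all_boot all_order all_algebra.
From mathcomp Require Import mathcomp_extra boolp classical_sets.
From mathcomp Require Import reals ereal topology normedtype sequences numfun.
From mathcomp Require Import set_interval.
From mathcomp Require Import ring lra.

Set Implicit Arguments.
Unset Strict Implicit.
Unset Printing Implicit Defensive.

Import Order.TTheory GRing.Theory Num.Theory.
Import numFieldNormedType.Exports.

Local Open Scope classical_set_scope.
Local Open Scope ring_scope.

(* Binary sequences are sequences of booleans, 1 being true and 0 being false. *)
Definition situation := seq bool.

(* Paths are indexed from 0: the entry omega_{n+1} of the mathematics
   is [omega n] here. *)
Definition omega_path := nat -> bool.

Definition initseg (omega : omega_path) (n : nat) : situation := mkseq omega n.

Record forecast (R : realType) := Forecast {
  fc_lo : R;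
  fc_hi : R;
  fc_lo_ge0 : 0 <= fc_lo;
  fc_le : fc_lo <= fc_hi;
  fc_hi_le1 : fc_hi <= 1 }.

Definition fc_set (R : realType) (I : forecast R) : set R :=
  `[fc_lo I, fc_hi I].

Definition gamble (R : realType) := bool -> R.

Definition expect (R : realType) (p : R) (f : gamble R) : R :=
  p * f true + (1 - p) * f false.

(* The infimum and supremum below are attained, see [lexpect_min] and
   [uexpect_max]. *)
Definition lexpect (R : realType) (I : forecast R) (f : gamble R) : R :=
  inf [set expect p f | p in fc_set I].

Definition uexpect (R : realType) (I : forecast R) (f : gamble R) : R :=
  sup [set expect p f | p in fc_set I].

Lemma expect_extrema (R : realType) (I : forecast R) (f : gamble R) :
  (exists2 p, fc_set I p &
     forall q, fc_set I q -> expect p f <= expect q f) /\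
  (exists2 p, fc_set I p &
     forall q, fc_set I q -> expect q f <= expect p f).
Proof.
have hlo : fc_set I (fc_lo I) by rewrite /fc_set /= in_itv /= lexx fc_le.
have hhi : fc_set I (fc_hi I) by rewrite /fc_set /= in_itv /= lexx fc_le.
rewrite /fc_set /expect.
have [h|/ltW h] := leP (f false) (f true); split.
- by exists (fc_lo I) => // q; rewrite /= in_itv /= => /andP[? ?]; nra.
- by exists (fc_hi I) => // q; rewrite /= in_itv /= => /andP[? ?]; nra.
- by exists (fc_hi I) => // q; rewrite /= in_itv /= => /andP[? ?]; nra.
- by exists (fc_lo I) => // q; rewrite /= in_itv /= => /andP[? ?]; nra.
Qed.

Lemma lexpect_min (R : realType) (I : forecast R) (f : gamble R) :
  (exists2 p, fc_set I p & lexpect I f = expect p f) /\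
  (forall q, fc_set I q -> lexpect I f <= expect q f).
Proof.
have [[p Ip pmin] _] := expect_extrema I f.
suff -> : lexpect I f = expect p f by split => //; exists p.
apply/eqP; rewrite eq_le; apply/andP; split.
  by apply: ge_inf; [exists (expect p f) => _ [q Iq <-]; exact: pmin|exists p].
by apply: lb_le_inf => [|_ [q Iq <-]]; [exists (expect p f), p|exact: pmin].
Qed.

Lemma uexpect_max (R : realType) (I : forecast R) (f : gamble R) :
  (exists2 p, fc_set I p & uexpect I f = expect p f) /\
  (forall q, fc_set I q -> expect q f <= uexpect I f).
Proof.
have [_ [p Ip pmax]] := expect_extrema I f.
suff -> : uexpect I f = expect p f by split => //; exists p.
apply/eqP; rewrite eq_le; apply/andP; split.
  by apply: ge_sup => [|_ [q Iq <-]]; [exists (expect p f), p|exact: pmax].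
by apply: ub_le_sup; [exists (expect p f) => _ [q Iq <-]; exact: pmax|exists p].
Qed.

Definition forecasting_system (R : realType) := situation -> forecast R.

Definition selection_process := situation -> bool.

Definition real_process (R : realType) := situation -> R.

Definition delta (R : realType) (F : real_process R) (s : situation) :
  gamble R := fun x => F (rcons s x) - F s.

Definition supermartingale (R : realType) (phi : forecasting_system R)
    (M : real_process R) : Prop :=
  forall s : situation, uexpect (phi s) (delta M s) <= 0.

Definition upper_prob (R : realType) (phi : forecasting_system R)
    (A : set omega_path) : \bar R :=
  ereal_inf [set (M [::])%:E | M in [set M : real_process R |
    supermartingale phi M /\
    forall omega : omega_path,
      ((\1_A omega : R)%:E <=
         limn_einf (fun n => (M (initseg omega n))%:E))%E]].

Definition null_event (R : realType) (phi : forecasting_system R)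
    (A : set omega_path) : Prop := upper_prob phi A = 0%E.

Definition almost_surely (R : realType) (phi : forecasting_system R)
    (P : omega_path -> Prop) : Prop :=
  null_event phi [set omega | ~ P omega].

Definition selected_count (R : realType) (S : selection_process)
    (omega : omega_path) (n : nat) : R :=
  \sum_(0 <= k < n) (S (initseg omega k))%:R.

(* In a field x / 0 = 0, so the average is 0 when nothing has been selected. *)
Definition selected_average (R : realType) (phi : forecasting_system R)
    (S : selection_process) (h : gamble R) (omega : omega_path) (n : nat) : R :=
  (\sum_(0 <= k < n) (S (initseg omega k))%:R *
     (h (omega k) - lexpect (phi (initseg omega k)) h))
  / selected_count R S omega n.

(* Main.v *)
(** Fix [eps > 0] and let [D] be the selected increments [h - lexpect h], bounded
    by [B].  Since [exp (- y - 2 y ^ 2) <= 1 - y] for [y <= 1/2], the process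
    [exp (- eps * sum D - 2 * eps ^ 2 * B ^ 2 * count)] is a supermartingale with
    initial value 1 as soon as [eps * B <= 1/2].  If the selected averages are
    below [- delta] infinitely often and [eps = delta / (4 B ^ 2)], this process
    is unbounded along the path.  Letting [delta] range over [1 / (j + 1)],
    stopping the [j]-th process when it reaches the level [2 ^ (j + 1) / e],
    dividing it by that level and summing over [j] gives a nonnegative
    supermartingale that starts at [e] and eventually stays at least 1 on
    the exceptional event. *)
Require Import Defs.
From mathcomp Require Import all_boot all_order all_algebra.
From mathcomp Require Import boolp classical_sets reals ereal topology normedtype sequences.
From mathcomp Require Import numfun exp ring lra.
Import Order.TTheory GRing.Theory Num.Theory.
Import numFieldNormedType.Exports.
Local Open Scope classical_set_scope.
Local Open Scope ring_scope.

(** * Lower limits *)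

Lemma limn_einf_ge (R : realType) (u : nat -> \bar R) (c : \bar R) (N : nat) :
  (forall n, (N <= n)%N -> (c <= u n)%E) -> (c <= limn_einf u)%E.
Proof.
move=> cu; rewrite limn_einf_lim (cvg_lim _ (@cvg_einfs_sup _ u))//.
apply: (@le_trans _ _ (einfs u N)); last by apply: ereal_sup_ubound; exists N.
by apply: le_ereal_inf_tmp => _ [n /= Nn <-]; exact: cu.
Qed.

Lemma limn_einf_le (R : realType) (u : nat -> \bar R) (c : \bar R) :
  (forall n, (u n <= c)%E) -> (limn_einf u <= c)%E.
Proof.
move=> uc; rewrite limn_einf_lim (cvg_lim _ (@cvg_einfs_sup _ u))//.
apply: ge_ereal_sup => _ [n _ <-].
by apply: le_trans (uc n); apply: ereal_inf_lbound; exists n => /=.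
Qed.

Lemma limn_einf_ge0 (R : realType) (u : nat -> R) :
  (forall j, exists N, forall n, (N <= n)%N -> - j.+1%:R^-1 <= u n) ->
  (0 <= limn_einf (fun n => (u n)%:E))%E.
Proof.
move=> H; apply/lee_addgt0Pr => e e0.
have [j je] : exists j, j.+1%:R^-1 <= e.
  exists (Num.bound e^-1).
  rewrite -[leRHS]invrK lef_pV2 ?posrE ?invr_gt0 ?ltr0n//.
  have /ltW := archi_boundP (ltW (eqbRL (invr_gt0 e) e0)).
  by move=> /le_trans; apply; rewrite ler_nat.
have [N HN] := H j; rewrite -leeBlDr// sub0e.
apply: (@limn_einf_ge _ _ _ N) => n /HN; rewrite -EFinN lee_fin.
by apply: le_trans; rewrite lerN2.
Qed.

(** * Supermartingales and nonnegativity of the upper probability *)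

Lemma fc_set_itv01 {R : realType} {I : forecast R} {p : R} :
  fc_set I p -> 0 <= p <= 1.
Proof.
rewrite /fc_set /= in_itv /= => /andP[lop phi].
by rewrite (le_trans (fc_lo_ge0 I))// (le_trans phi)// fc_hi_le1.
Qed.

Lemma supermartingaleP {R : realType} {phi : forecasting_system R}
    {M : real_process R} :
  supermartingale phi M <->
  forall s p, fc_set (phi s) p ->
    p * M (rcons s true) + (1 - p) * M (rcons s false) <= M s.
Proof.
split=> [HM s p /(proj2 (uexpect_max _ (delta M s)))|HM s].
  have := HM s; rewrite /expect /delta; nra.
have [[p Ip ->] _] := uexpect_max (phi s) (delta M s).
have := HM _ _ Ip; rewrite /expect /delta; nra.
Qed.

Lemma initsegS (omega : omega_path) (n : nat) :
  initseg omega n.+1 = rcons (initseg omega n) (omega n).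
Proof. exact: mkseqS. Qed.

(* Following at each situation an outcome for which [M] does not increase
   gives a path on which [M] stays below its initial value. *)
Lemma supermartingale_descent {R : realType} {phi : forecasting_system R}
    {M : real_process R} : supermartingale phi M ->
  exists omega, forall n, M (initseg omega n) <= M [::].
Proof.
move=> /supermartingaleP HM.
pose down s := ~~ (M (rcons s false) <= M s).
have downP s : M (rcons s (down s)) <= M s.
  rewrite /down; case: (lerP (M (rcons s false)) (M s)) => //= lt0.
  (* The zero gamble serves only to produce a point of the interval. *)
  have [[p Ip _] _] := lexpect_min (phi s) (fun=> 0).
  have := HM _ _ Ip; have /andP[p0 p1] := fc_set_itv01 Ip.
  move=> H; rewrite leNgt; apply/negP => lt1.
  case: (eqVneq p 1) H => [-> H|pneq1 H]; first by nra.
  have : 0 < 1 - p by rewrite subr_gt0 lt_neqAle pneq1.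
  nra.
pose st n := iter n (fun s => rcons s (down s)) [::].
exists (fun n => down (st n)) => n.
suff -> : initseg (fun n => down (st n)) n = st n.
  by elim: n => //= n; apply: le_trans.
by elim: n => // n IH; rewrite initsegS IH.
Qed.

(** Along the path of [supermartingale_descent] the lower limit is at most [M [::]], which therefore
    cannot be negative. *)
Lemma upper_prob_ge0 {R : realType} (phi : forecasting_system R)
    (A : set omega_path) : (0 <= upper_prob phi A)%E.
Proof.
apply: le_ereal_inf_tmp => _ [M [smM MA] <-].
have [omega Homega] := supermartingale_descent smM.
have := MA omega; apply: contraTT; rewrite -!ltNge => M0.
apply: (@le_lt_trans _ _ (M [::])%:E).
  by apply: limn_einf_le => n; rewrite lee_fin.
by apply: (lt_le_trans M0); rewrite lee_fin indicE.
Qed.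

(** * Stopped processes *)

Section stopping.
Variables (R : realType) (C : R) (F : real_process R).

(* The longest prefix of [s] with no proper prefix at which [F] reaches [C]. *)
Definition stop (s : situation) : situation :=
  foldl (fun t x => if C <= F t then t else rcons t x) [::] s.

Lemma stop_rcons s x :
  stop (rcons s x) = if C <= F (stop s) then stop s else rcons (stop s) x.
Proof. by rewrite /stop foldl_rcons. Qed.

Lemma stop_id s : F (stop s) < C -> stop s = s.
Proof.
elim/last_ind: s => // s x IH; rewrite stop_rcons.
by case: (lerP C (F (stop s))) => [le /lt_geF|/IH ->//]; rewrite le.
Qed.

Lemma size_stop s : (size (stop s) <= size s)%N.
Proof.
elim/last_ind: s => // s x IH; rewrite stop_rcons.
by case: ifP => _; rewrite ?size_rcons ?ltnS// leqW.
Qed.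

Lemma stop_reached omega n m :
  C <= F (initseg omega n) -> (n <= m)%N -> C <= F (stop (initseg omega m)).
Proof.
move=> Cn /subnKC <-; elim: (m - n)%N => [|k IH].
  by rewrite addn0 leNgt; apply/negP => /[dup] /stop_id ->; rewrite ltNge Cn.
by rewrite addnS initsegS stop_rcons IH.
Qed.

(** Once stopped, both children keep the parent's value; until then the inequality is that of
    [F]. *)
Lemma supermartingale_stop phi :
  supermartingale phi F -> supermartingale phi (F \o stop).
Proof.
move=> /supermartingaleP HF; apply/supermartingaleP => s p Ip /=.
rewrite !stop_rcons; case: (lerP C (F (stop s))) => [_|/stop_id ->]; last exact: HF.
by rewrite -mulrDl addrC subrK mul1r.
Qed.

End stopping.
Arguments stop {R} C F s.
Arguments stop_reached {R C F omega n m}.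
Arguments supermartingale_stop {R} C {F phi}.

(** * Null events from unbounded supermartingales *)

Lemma null_unbounded {R : realType} {phi : forecasting_system R}
    {F : nat -> real_process R} {K : nat -> R} {A : set omega_path} :
  (forall j, supermartingale phi (F j)) ->
  (forall j s, 0 <= F j s) -> (forall j, F j [::] = 1) ->
  {homo K : m n / (m <= n)%N >-> m <= n} ->
  (forall j s, F j s <= K (size s)) ->
  (forall omega, A omega ->
     exists j, forall C, exists n, C <= F j (initseg omega n)) ->
  null_event phi A.
Proof.
move=> smF F0 F1 Khomo FK FA.
apply/eqP; rewrite eq_le upper_prob_ge0 andbT; apply/lee_addgt0Pr => e e0.
rewrite add0e.
(* The weights [a j = e / 2 ^ (j + 1)] sum to [e]; [(a j)^-1] is the stopping level of [F j]. *)
pose a := geometric (e / 2) 2^-1.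
have a0 j : 0 < a j by rewrite /a /= mulr_gt0 ?divr_gt0 ?exprn_gt0 ?invr_gt0.
have half1 : `|2^-1 : R| < 1 by rewrite ger0_norm; lra.
have cva : cvgn (series a) by exact: is_cvg_geometric_series.
have lima : limn (series a) = e.
  have /cvg_lim -> // := @cvg_geometric_series R (e / 2) _ half1.
  by field.
pose T j s := F j (stop (a j)^-1 (F j) s).
have T0 j s : 0 <= T j s by exact: F0.
pose t s j := a j * T j s.
have t0 s j : 0 <= t s j by rewrite mulr_ge0// ltW.
(* Stopping can only shorten [s], so the monotone bound [K], common to all [j], dominates the terms
   by [K (size s) * a j]. *)
have cvt s : cvgn (series (t s)).
  apply: (@series_le_cvg _ (t s) (fun j => K (size s) * a j)) => [//|j|j|].
  - by rewrite mulr_ge0 ?(ltW (a0 _))//; apply: le_trans (FK 0%N s).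
  - rewrite /t mulrC ler_wpM2r ?(ltW (a0 _))//.
    by apply: le_trans (FK _ _) _; apply: Khomo; exact: size_stop.
  - exact: is_cvg_seriesZ.
pose M s := limn (series (t s)).
have Mt s j : t s j <= M s.
  apply: (@le_trans _ _ (series (t s) j.+1)).
    by rewrite /series /= big_nat_recr//= lerDr sumr_ge0.
  by apply: nondecreasing_cvgn_le => //; apply: nondecreasing_series => n _ _.
have M0 s : 0 <= M s by apply: le_trans (t0 s 0%N) (Mt s 0%N).
apply: (@le_trans _ _ (M [::])%:E).
  apply: ereal_inf_lbound; exists M => //; split => [|omega].
    apply/supermartingaleP => s p Ip.
    have cv : p * series (t (rcons s true)) n + (1 - p) * series (t (rcons s false)) n
        @[n --> \oo] --> p * M (rcons s true) + (1 - p) * M (rcons s false).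
      by apply: cvgD; (apply: cvgM; [exact: cvg_cst|exact: cvt]).
    rewrite -(cvg_lim _ cv)//; apply: ler_lim => //; first exact: cvgP cv.
    apply: nearW => n; rewrite /series /= !mulr_sumr -big_split /=.
    apply: ler_sum => j _; rewrite /t.
    have /supermartingaleP/(_ s p Ip)/= := supermartingale_stop (a j)^-1 (smF j).
    have := a0 j; rewrite /T; nra.
  have [Aw|nAw] := pselect (A omega); last first.
    rewrite indicE memNset//; apply: (@limn_einf_ge _ _ _ 0%N) => n _.
    by rewrite lee_fin.
  rewrite indicE mem_set//.
  have [j /(_ (a j)^-1)[n Hn]] := FA _ Aw.
  apply: (@limn_einf_ge _ _ _ n) => m nm; rewrite lee_fin.
  (* From time [n] on, the [j]-th term alone is at least [a j * (a j)^-1 = 1]. *)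
  apply: le_trans (Mt _ j); rewrite /t -[leLHS](@mulfV _ (a j)) ?gt_eqF//.
  by rewrite ler_wpM2l ?(ltW (a0 _))//; exact: stop_reached Hn nm.
rewrite lee_fin -lima /M; suff -> : t [::] = a by [].
by apply/funext => j; rewrite /t /T /stop /= F1 mulr1.
Qed.

(** * Additive processes and their exponentials *)

Section additive.
Context {R : realType}.
Implicit Types (w : situation -> gamble R) (s : situation).

Definition additive_process w s : R :=
  \sum_(0 <= k < size s) w (take k s) (nth false s k).

Lemma additive_rcons w s x :
  additive_process w (rcons s x) = additive_process w s + w s x.
Proof.
rewrite /additive_process size_rcons big_nat_recr//=.
rewrite nth_rcons ltnn eqxx -cats1 take_size_cat//; congr (_ + _).
apply: eq_big_nat => k /andP[_ ks].
by rewrite nth_cat ks takel_cat// ltnW.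
Qed.

Lemma additive_initseg w omega n :
  additive_process w (initseg omega n) =
  \sum_(0 <= k < n) w (initseg omega k) (omega k).
Proof.
elim: n => [|n IH]; first by rewrite /additive_process !big_geq.
by rewrite initsegS additive_rcons IH big_nat_recr.
Qed.

Lemma additive_le_size w s :
  (forall s x, w s x <= 1) -> additive_process w s <= (size s)%:R.
Proof.
move=> w1; elim/last_ind: s => [|s x IH].
  by rewrite /additive_process big_geq.
by rewrite additive_rcons size_rcons -natr1 lerD.
Qed.

Lemma supermartingale_expR_additive phi w :
  (forall s p, fc_set (phi s) p -> expect p (fun x => expR (w s x)) <= 1) ->
  supermartingale phi (fun s => expR (additive_process w s)).
Proof.
move=> w1; apply/supermartingaleP => s p Ip.
rewrite !additive_rcons !expRD; have := w1 s p Ip.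
have := expR_gt0 (additive_process w s); rewrite /expect; nra.
Qed.

End additive.

(** With [z = y + 2 * y ^+ 2], [expR (- z) <= (1 + z)^-1], and [(1 - y) * (1 + z) = 1 + y ^+ 2 * (1
    - 2 * y) >= 1]. *)
Lemma expR_le_subr {R : realType} (y : R) :
  y <= 2^-1 -> expR (- (y + 2 * y ^+ 2)) <= 1 - y.
Proof.
move=> y2; rewrite expRN.
have z0 : 0 < 1 + (y + 2 * y ^+ 2).
  (* The left side of the square completion is [2 * (y + 1/4) ^+ 2 + 7/8]. *)
  by have := sqr_ge0 (y + 4^-1); rewrite !expr2; nra.
apply: (@le_trans _ _ (1 + (y + 2 * y ^+ 2))^-1).
  by rewrite lef_pV2 ?posrE ?expR_gt0// expR_ge1Dx.
rewrite -[leLHS]mul1r ler_pdivrMr//.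
have -> : (1 - y) * (1 + (y + 2 * y ^+ 2)) = 1 + y ^+ 2 * (1 - 2 * y) by ring.
by rewrite lerDl mulr_ge0 ?sqr_ge0//; lra.
Qed.

Lemma norm_sub_lexpect {R : realType} (I : forecast R) (h : gamble R) x :
  `|h x - lexpect I h| <= `|h true - h false|.
Proof.
have [[p /fc_set_itv01/andP[p0 p1] ->] _] := lexpect_min I h.
have -> : h x - expect p h = (x%:R - p) * (h true - h false).
  by rewrite /expect; case: x => /=; ring.
rewrite normrM ler_piMl// ler_norml; case: x => /=; lra.
Qed.

(** * The exponential supermartingale of the selected increments *)

Section exponential.
Variables (R : realType) (phi : forecasting_system R) (S : selection_process).
Variables (h : gamble R) (B eps : R).
Hypothesis hB : `|h true - h false| <= B.
Hypothesis eps0 : 0 <= eps.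
Hypothesis epsB : eps * B <= 2^-1.

(** The constant [2 * (eps * B) ^+ 2] replaces the quadratic term of [expR_le_subr], so that the
    total correction depends only on the selected count. *)
Definition log_increment (s : situation) : gamble R := fun x =>
  - (S s)%:R * (eps * (h x - lexpect (phi s) h) + 2 * (eps * B) ^+ 2).

Let incr_le s x :
  eps * (h x - lexpect (phi s) h) <= 2^-1 /\
  - (eps * (h x - lexpect (phi s) h)) <= 2^-1 /\
  (eps * (h x - lexpect (phi s) h)) ^+ 2 <= (eps * B) ^+ 2.
Proof.
have hb : `|eps * (h x - lexpect (phi s) h)| <= eps * B.
  rewrite normrM ger0_norm// ler_wpM2l//.
  exact: le_trans (norm_sub_lexpect _ _ _) hB.
split; first exact: le_trans (ler_norm _) (le_trans hb epsB).
split; first by apply: le_trans (ler_norm _) _; rewrite normrN (le_trans hb).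
by rewrite -[leLHS]real_normK ?num_real// lerXn2r ?nnegrE// (le_trans _ hb).
Qed.

(** This yields a majorant [expR n] at length [n] that is the same for every [eps]. *)
Lemma log_increment_le1 s x : log_increment s x <= 1.
Proof.
have [_ [le2 _]] := incr_le s x.
by rewrite /log_increment; have := sqr_ge0 (eps * B); case: (S s) => /=; lra.
Qed.

(** A selected factor is at most [1 - eps * (h x - lexpect (phi s) h)], of expectation at most 1
    since [lexpect] is a minimum; an unselected factor is 1. *)
Lemma supermartingale_log_increment :
  supermartingale phi (fun s => expR (additive_process log_increment s)).
Proof.
apply: supermartingale_expR_additive => s p Ip; rewrite /log_increment /expect.
case: (S s) => /=; last by rewrite !oppr0 !mul0r expR0; lra.
have incr x : expR (- 1%:R * (eps * (h x - lexpect (phi s) h) + 2 * (eps * B) ^+ 2))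
    <= 1 - eps * (h x - lexpect (phi s) h).
  have [le1 [_ sqle]] := incr_le s x; apply: le_trans (expR_le_subr _ le1).
  by rewrite ler_expR; lra.
have /andP[p0 p1] := fc_set_itv01 Ip.
have := proj2 (lexpect_min (phi s) h) _ Ip; rewrite /expect => Eh.
have /(ler_wpM2l p0) := incr true.
have /(ler_wpM2l (eqbRL (subr_ge0 _ _) p1)) := incr false.
have := ler_wpM2l eps0 Eh; nra.
Qed.

Lemma additive_log_increment omega n : 0 < selected_count R S omega n ->
  additive_process log_increment (initseg omega n) =
  - selected_count R S omega n *
    (eps * selected_average phi S h omega n + 2 * (eps * B) ^+ 2).
Proof.
move=> /lt0r_neq0 N0; rewrite additive_initseg.
set N := selected_count _ _ _ _ in N0 *.
have -> : - N * (eps * selected_average phi S h omega n + 2 * (eps * B) ^+ 2) =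
    - (eps * (selected_average phi S h omega n * N) + 2 * (eps * B) ^+ 2 * N).
  by ring.
rewrite divfK// !mulr_sumr -big_split -sumrN.
by apply: eq_bigr => k _; rewrite /log_increment /=; ring.
Qed.

End exponential.
Arguments log_increment {R}.
Arguments log_increment_le1 {R} phi S {h B eps}.
Arguments supermartingale_log_increment {R} phi S {h B eps}.

(** * Choice of the constants and conclusion *)

Theorem theorem21 (R : realType) (phi : forecasting_system R)
    (S : selection_process) (h : gamble R) :
  almost_surely phi (fun omega : omega_path =>
    selected_count R S omega n @[n --> \oo] --> +oo ->
    (0 <= limn_einf (fun n => (selected_average phi S h omega n)%:E))%E).
Proof.
(* Adding 1 keeps [B] positive when [h] is constant. *)
pose B := `|h true - h false| + 1.
have B1 : 1 <= B by rewrite /B lerDr.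
pose delta j : R := j.+1%:R^-1.
have delta0 j : 0 < delta j by rewrite invr_gt0.
have delta1 j : delta j <= 1 by rewrite invf_le1 ?ler1n.
(* This makes [2 * (eps j * B) ^+ 2] half of [eps j * delta j], the gain per selection when the
   average is below [- delta j]. *)
pose eps j := delta j / (4 * B ^+ 2).
have eps0 j : 0 < eps j by rewrite divr_gt0// mulr_gt0// exprn_gt0//; lra.
have epsB2 j : (eps j * B) ^+ 2 = eps j * delta j / 4.
  by rewrite /eps; field; lra.
have epsB j : eps j * B <= 2^-1.
  suff -> : eps j * B = delta j / (4 * B).
    by rewrite ler_pdivrMr; [have := delta1 j; lra|lra].
  by rewrite /eps; field; lra.
have hB : `|h true - h false| <= B by rewrite lerDl.
pose L j := additive_process (log_increment phi S h B (eps j)).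
apply: (@null_unbounded _ _ (fun j s => expR (L j s)) (fun n => expR n%:R)).
- move=> j; exact: (supermartingale_log_increment phi S hB (ltW (eps0 j)) (epsB j)).
- by move=> j s; exact: expR_ge0.
- by move=> j; rewrite /L /additive_process big_geq// expR0.
- by move=> m n mn; rewrite ler_expR ler_nat.
- move=> j s; rewrite ler_expR; apply: additive_le_size => {}s x.
  exact: (log_increment_le1 phi S hB (ltW (eps0 j)) (epsB j)).
move=> omega /not_implyP[/cvgryPge Ncvg nlim].
have /existsNP[j /forallNP Hj] : ~ forall j, exists N, forall n, (N <= n)%N ->
    - delta j <= selected_average phi S h omega n.
  by move=> H; apply: nlim; exact: limn_einf_ge0.
exists j => C; have ed : 0 < eps j * delta j by rewrite mulr_gt0.
(* A count of at least 1 avoids the zero denominator; the other bound brings the exponent, at least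
   half the count times [eps j * delta j], up to [C]. *)
have [N _ HN] := Ncvg (Num.max 1 (2 * C / (eps j * delta j))).
have /existsNP[n /not_implyP[Nn /negP]] := Hj N; rewrite -ltNge => avg.
have := HN n Nn; rewrite /= ge_max ler_pdivrMr// => /andP[cnt1 cntC].
exists n; apply: le_trans (expR_ge1Dx _); rewrite /L.
rewrite additive_log_increment ?(lt_le_trans _ cnt1)// epsB2.
set N' := selected_count _ _ _ _ in cnt1 cntC *.
set v := selected_average _ _ _ _ _ in avg *.
have : eps j * v <= - (eps j * delta j) by have := eps0 j; nra.
nra.
Qed.
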